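(* Let $N\in\mathbb{N}$ and $\Delta t=1/N$. Then: (a) There exist $C>0$ and $\rho>0$, independent of $\phi$ and of $\tau$, such that $$\sup_{\tau\in\mathbb{T},\,\mathbf{x}\in\tilde Y}\Big|\big((I_{\Delta t})^{N}\big)^n\phi(\tau,\mathbf{x})-\int_{\tilde Y}\phi(\tau,\mathbf{x}')\,\pi_\tau(\mathrm{d}\mathbf{x}')\Big|\le C\|\phi\|_{L^\infty}e^{-\rho n}\qquad\forall\phi\in\mathcal{B}(\mathbb{T}\times\tilde Y),\ \forall n\in\mathbb{N}.$$ (b) If $\phi\in\mathcal{B}(\mathbb{T}\times\tilde Y)$ satisfies $\int_{\tilde Y}\phi(s,\mathbf{x})\,\pi_s(\mathrm{d}\mathbf{x})=0$ for all $s\in\mathbb{T}$, then for every $\tau\in\mathbb{T}$ and every starting point, the series $\sum_{i=1}^{\infty}\mathbb{E}\,\phi(\tau+i\Delta t,\mathbf{X}^{i})$, with $\mathbf{X}^i$ the chain started at time $\tau$, converges (its partial sums have a finite limit). (c) The kernel of $I_d-(I_{\Delta t})^N$ on $\mathcal{B}(\mathbb{T}\times\tilde Y)$ is exactly the set of functions $w(\tau,\mathbf{x})=c(\tau)$ depending only on $\tau$, with $c$ $1$-periodic.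
   Context: Let $\mathbb{T}=\mathbb{R}/\mathbb{Z}$ (time torus) and $\tilde Y=\mathbb{R}^2/\mathbb{Z}^2$ (spatial torus). Let $\sigma>0$. Let $v_1(t,x_2)$ and $v_2(t,x_1)$ be smooth real functions, $1$-periodic in each argument (so $v_1$ does not depend on $x_1$ and $v_2$ does not depend on $x_2$), with $\int_0^1 v_1(t,x_2)\,\mathrm{d}x_2=0$ for all $t$ and $\int_0^1 v_2(t,x_1)\,\mathrm{d}x_1=0$ for all $t$. Let $N\in\mathbb{N}$ and $\Delta t=1/N$. For a starting time $\tau\in\mathbb{R}$ and starting point $\mathbf{X}^0=(x_1^0,x_2^0)$, the numerical scheme generates the Markov chain $\mathbf{X}^n=(x_1^n,x_2^n)$ by $$x_1^{n+1}=x_1^n+v_1(\tau+(n+\tfrac12)\Delta t,x_2^n)\Delta t+\sigma\sqrt{\Delta t}\,\xi_1^n,$$ $$x_2^{n+1}=x_2^n+v_2\big(\tau+(n+\tfrac12)\Delta t,\;x_1^n+v_1(\tau+(n+\tfrac12)\Delta t,x_2^n)\Delta t\big)\Delta t+\sigma\sqrt{\Delta t}\,\xi_2^n,$$ where $\xi_1^n,\xi_2^n$ are i.i.d. $\mathcal{N}(0,1)$. By periodicity the chain is well defined on $\tilde Y$. $\mathcal{B}(S)$ is the space of bounded measurable functions on $S$. The one-step space-time operator $I_{\Delta t}$ on $\mathcal{B}(\mathbb{T}\times\tilde Y)$ is $(I_{\Delta t}\phi)(\tau,\mathbf{x})=\mathbb{E}[\phi(\tau+\Delta t,\mathbf{X}^1)\mid\mathbf{X}^0=\mathbf{x}]$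 for the chain started at time $\tau$; thus $((I_{\Delta t})^N\phi)(\tau,\cdot)=I_{\tau,1+\tau}\phi(\tau,\cdot)$, where $(I_{\tau,1+\tau}\psi)(\mathbf{x})=\mathbb{E}[\psi(\mathbf{X}^N)\mid\mathbf{X}^0=\mathbf{x}]$ (chain started at time $\tau$). For each $\tau$, $\pi_\tau$ denotes the unique invariant probability measure of $I_{\tau,1+\tau}$ on $\tilde Y$. *)

(* Defs.v *)
From HB Require Import structures.
From mathcomp Require Import all_boot all_order all_algebra.
From mathcomp Require Import all_classical all_reals all_analysis.
Set Implicit Arguments. Unset Strict Implicit. Unset Printing Implicit Defensive.
Import Order.TTheory GRing.Theory Num.Theory.
Import numFieldNormedType.Exports.
Local Open Scope classical_set_scope.
Local Open Scope ring_scope.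

Section Defs.
Variable R : realType.

Fixpoint Ck2 (k : nat) (f : R -> R -> R) : Prop :=
  match k with
  | 0%N => continuous (fun p : R * R => f p.1 p.2)
  | k'.+1 =>
      (forall a b : R, derivable (fun s => f s b) a 1 /\ derivable (f a) b 1)
      /\ Ck2 k' (fun a b => derive1 (fun s => f s b) a)
      /\ Ck2 k' (fun a b => derive1 (f a) b)
  end.

Definition smooth2 (f : R -> R -> R) : Prop := forall k, Ck2 k f.

Definition gauss (z : R) : R := expR (- (z ^+ 2) / 2) / Num.sqrt (2 * pi).

Definition Rint (f : R -> R) : R := Rintegral lebesgue_measure setT f.

(* A space-time function phi(tau, x) on T x Y~, represented by a function
   on R x R^2 that is 1-periodic in each variable. *)
Definition stfun := R -> R * R -> R.

Definition st_periodic (phi : stfun) : Prop :=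
  forall t x1 x2, phi (t + 1) (x1, x2) = phi t (x1, x2)
               /\ phi t (x1 + 1, x2) = phi t (x1, x2)
               /\ phi t (x1, x2 + 1) = phi t (x1, x2).

Definition inB (phi : stfun) : Prop :=
  measurable_fun setT (fun p : R * (R * R) => phi p.1 p.2)
  /\ (exists M : R, forall t x, `|phi t x| <= M)
  /\ st_periodic phi.

Definition supnorm (phi : stfun) : R :=
  sup [set `|phi p.1 p.2| | p in [set: R * (R * R)]].

(* one-step space-time operator I_{Delta t}:
   (I phi)(tau,x) = E[phi(tau + dt, X^1) | X^0 = x], chain started at tau.
   X^1 = m(tau,x) + sigma sqrt(dt) (xi_1, xi_2) with xi_i iid N(0,1). *)
Definition one_step (N : nat) (sigma : R) (v1 v2 : R -> R -> R)
    (phi : stfun) : stfun :=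
  fun tau x =>
    let dt := (N%:R)^-1 in
    let th := tau + dt / 2 in
    let y1 := x.1 + v1 th x.2 * dt in
    let m2 := x.2 + v2 th y1 * dt in
    let s := sigma * Num.sqrt dt in
    Rint (fun z1 => Rint (fun z2 =>
      phi (tau + dt) (y1 + s * z1, m2 + s * z2) * gauss z1 * gauss z2)).

(* I_{tau,1+tau} psi (x) = E[psi(X^N) | X^0 = x], chain started at tau *)
Definition period_op (N : nat) (sigma : R) (v1 v2 : R -> R -> R)
    (tau : R) (psi : R * R -> R) : R * R -> R :=
  iter N (one_step N sigma v1 v2) (fun _ => psi) tau.

(* pi is an invariant probability measure of I_{tau,1+tau} (on the torus,
   tested against bounded measurable periodic functions) *)
Definition inv_prob (N : nat) (sigma : R) (v1 v2 : R -> R -> R)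
    (tau : R) (pi : probability (R * R)%type R) : Prop :=
  forall psi : R * R -> R,
    measurable_fun setT psi ->
    (exists M : R, forall x, `|psi x| <= M) ->
    (forall x1 x2, psi (x1 + 1, x2) = psi (x1, x2)
                /\ psi (x1, x2 + 1) = psi (x1, x2)) ->
    Rintegral pi setT (period_op N sigma v1 v2 tau psi)
    = Rintegral pi setT psi.

End Defs.

(* Main.v *)
(* Write [phi_t] for the time slice of [phi]. One step of the scheme adds a
   non-degenerate Gaussian to a deterministic point, so by periodicity its law
     on
   the torus dominates a fixed multiple [eps] of the uniform law, whatever the
   drift. Hence (Doeblin) each step shrinks the oscillation of a periodic
     function
   by the factor [q = 1 - eps], and an invariant measure integrates a slice to a
   value within the range of each of its iterates; this gives (a) with rate
   [q ^ N] per period, and (b), (c) follow. For existence of the invariant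
     measure,
   the iterates started at one point converge, uniformly on bounded functions,
     to
   a functional that is continuous under bounded pointwise convergence, hence is
   the integral against a probability measure (Daniell). *)
Require Import Defs.
From HB Require Import structures.
From mathcomp Require Import all_boot all_order all_algebra.
From mathcomp Require Import all_classical all_reals all_analysis.
From mathcomp Require Import finmap measurable_realfun lra.
Set Implicit Arguments. Unset Strict Implicit. Unset Printing Implicit
  Defensive.
Import Order.TTheory GRing.Theory Num.Theory.
Import numFieldNormedType.Exports.
Local Open Scope classical_set_scope.
Local Open Scope ring_scope.

(** * Expectation functionals on bounded measurable functions *)

Section BoundedMeasurable.
Context d (T : measurableType d) (R : realType).
Implicit Types (f g : T -> R) (P : probability T R).

Definition bmeas f := measurable_fun setT f /\ exists M : R, forall x, `|f x|
  <= M.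

Lemma bmeas_cst c : bmeas (cst c).
Proof. by split => //; exists `|c|. Qed.

Lemma bmeasD f g : bmeas f -> bmeas g -> bmeas (fun x => f x + g x).
Proof.
move=> [mf [M fM]] [mg [M' gM]]; split; first exact: measurable_funD.
by exists (M + M') => x; rewrite (le_trans (ler_normD _ _))// lerD.
Qed.

Lemma bmeasZ c f : bmeas f -> bmeas (fun x => c * f x).
Proof.
move=> [mf [M fM]]; split; first exact: measurable_funM.
by exists (`|c| * M) => x; rewrite normrM ler_wpM2l.
Qed.

Lemma bmeasN f : bmeas f -> bmeas (fun x => - f x).
Proof.
by move=> [mf [M fM]]; split; [exact: measurableT_comp|exists M => x;
  rewrite normrN].
Qed.

Lemma bmeasB f g : bmeas f -> bmeas g -> bmeas (fun x => f x - g x).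
Proof. by move=> bf bg; apply: bmeasD => //; exact: bmeasN. Qed.

Lemma bmeas_indic (A : set T) : measurable A -> bmeas (\1_A : T -> R).
Proof.
move=> mA; split; first exact: measurable_indic.
by exists 1 => x; rewrite indicE; case: (x \in A); rewrite ?normr1 ?normr0.
Qed.

Lemma bmeas_integrable P f : bmeas f -> P.-integrable setT (EFin \o f).
Proof.
move=> [mf [M fM]]; apply: measurable_bounded_integrable => //.
  by rewrite (le_lt_trans (probability_le1 P _)) ?ltry.
exists M; split; first exact: num_real.
by move=> y My x _; exact: le_trans (fM x) (ltW My).
Qed.

(* Expectations restricted to bounded measurable functions; [bexp_cvg0] is the
   Daniell continuity that makes such a functional come from a measure. *)
Record bexp (E : (T -> R) -> R) : Prop := Bexp {
  bexpD : forall f g, bmeas f -> bmeas g -> E (fun x => f x + g x) = E f + E g ;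
  bexpZ : forall c f, bmeas f -> E (fun x => c * f x) = c * E f ;
  bexp_ge0 : forall f, bmeas f -> (forall x, 0 <= f x) -> 0 <= E f ;
  bexp1 : E (cst 1) = 1 ;
  bexp_cvg0 : forall (f_ : nat -> T -> R) (M : R), (forall n, bmeas (f_ n)) ->
    (forall n x, `|f_ n x| <= M) -> (forall x, f_ ^~ x @ \oo --> (0 : R)) ->
    E (f_ n) @[n --> \oo] --> (0 : R) }.

Lemma bexp_Rintegral P : bexp (Rintegral P setT).
Proof.
split.
- by move=> f g bf bg; rewrite RintegralD//; exact: bmeas_integrable.
- by move=> c f bf; rewrite RintegralZl//; exact: bmeas_integrable.
- by move=> f _ f0; exact: Rintegral_ge0.
- by rewrite Rintegral_cst//= probability_setT mulr1.
- move=> f_ M bf fM f0.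
  have [|||||_ _] := @dominated_convergence _ _ _ P setT measurableT
      (fun n => EFin \o f_ n) (cst 0%E) (cst M%:E).
  + by move=> n; apply/measurable_EFinP; exact: (bf n).1.
  + exact: measurable_cst.
  + apply: aeW => x _; apply/fine_cvgP; split; first by apply: nearW.
    exact: f0.
  + exact: (@bmeas_integrable P (cst M) (bmeas_cst M)).
  + by apply: aeW => x n _; rewrite /= lee_fin.
  by rewrite integral0 => /fine_cvgP[].
Qed.

Section BexpTheory.
Variables (E : (T -> R) -> R) (HE : bexp E).

Lemma bexp_cst c : E (cst c) = c.
Proof.
by rewrite -[RHS]mulr1 -(bexp1 HE) -bexpZ//;
  [under eq_fun do rewrite mulr1|exact: bmeas_cst].
Qed.

Lemma bexpB f g : bmeas f -> bmeas g -> E (fun x => f x - g x) = E f - E g.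
Proof.
move=> bf bg; rewrite bexpD//; last exact: bmeasN.
by rewrite -mulN1r -(bexpZ HE _ bg); congr (_ + E _); apply/funext => x;
  rewrite mulN1r.
Qed.

Lemma bexp_le f g : bmeas f -> bmeas g -> (forall x, f x <= g x) -> E f <= E g.
Proof.
move=> bf bg fg; rewrite -subr_ge0 -bexpB//; apply: bexp_ge0 => //.
  exact: bmeasB.
by move=> x; rewrite subr_ge0.
Qed.

Lemma bexp_itv f a b : bmeas f -> (forall x, a <= f x <= b) -> a <= E f <= b.
Proof.
move=> bf fab; have lb x : a <= f x by case/andP: (fab x).
have ub x : f x <= b by case/andP: (fab x).
have := bexp_le (bmeas_cst a) bf lb; have := bexp_le bf (bmeas_cst b) ub.
by rewrite !bexp_cst => -> ->.
Qed.

Lemma bexp_norm f M : bmeas f -> (forall x, `|f x| <= M) -> `|E f| <= M.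
Proof. by move=> bf fM; rewrite ler_norml bexp_itv// => x;
  rewrite -ler_norml. Qed.

Lemma bmeas_sum (f_ : nat -> T -> R) n : (forall i, bmeas (f_ i)) ->
  bmeas (fun x => \sum_(0 <= i < n) f_ i x).
Proof.
move=> bf; elim: n => [|n IH].
  by under eq_fun do rewrite big_nil; exact: bmeas_cst.
by under eq_fun do rewrite big_nat_recr//=; exact: bmeasD.
Qed.

Lemma bexp_sum (f_ : nat -> T -> R) n : (forall i, bmeas (f_ i)) ->
  E (fun x => \sum_(0 <= i < n) f_ i x) = \sum_(0 <= i < n) E (f_ i).
Proof.
move=> bf; elim: n => [|n IH].
  by under eq_fun do rewrite big_nil; rewrite big_nil bexp_cst.
under eq_fun do rewrite big_nat_recr//=; rewrite big_nat_recr//= -IH bexpD//.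
exact: bmeas_sum.
Qed.

(** Continuity at 0 applied to [f_ n - f], which is bounded by [M + K] uniformly in [n]. *)
Lemma bexp_cvg (f_ : nat -> T -> R) f M : (forall n, bmeas (f_ n)) ->
  bmeas f -> (forall n x, `|f_ n x| <= M) -> (forall x, f_ ^~ x @ \oo --> f x)
    ->
  E (f_ n) @[n --> \oo] --> E f.
Proof.
move=> bf_ bf fM ff; have [mf [K fK]] := bf.
apply/subr_cvg0.
rewrite (_ : (fun n => _) = (fun n => E (fun x => f_ n x - f x))); last first.
  by apply/funext => n; rewrite bexpB.
apply: (bexp_cvg0 HE (M := M + K)).
- by move=> n; exact: bmeasB.
- by move=> n x; rewrite (le_trans (ler_normB _ _))// lerD.
- by move=> x; apply/subr_cvg0; exact: ff.
Qed.

End BexpTheory.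
End BoundedMeasurable.

(** * Uniqueness of a functional given its values on indicators *)

Section BexpUnique.
Context d (T : measurableType d) (R : realType).
Variables (E E' : (T -> R) -> R) (HE : bexp E) (HE' : bexp E').
Hypothesis EE' : forall A, measurable A -> E (\1_A) = E' (\1_A).
Import HBNNSimple.

Lemma bexp_nnsfun_unique (f : {nnsfun T >-> R}) : E f = E' f.
Proof.
pose s := fset_set (f @` setT).
have -> : (f : T -> R) = (fun x => \sum_(0 <= i < #|`s|) (s`_i * \1_(f @^-1`
  [set s`_i]) x)).
  by apply/funext => x; rewrite big_mkord fimfunEord.
have bA i : bmeas (\1_(f @^-1` [set s`_i]) : T -> R) by exact: bmeas_indic.
rewrite (bexp_sum HE); last by move=> i; exact: bmeasZ.
rewrite (bexp_sum HE'); last by move=> i; exact: bmeasZ.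
by apply: eq_bigr => i _; rewrite (bexpZ HE)// (bexpZ HE')// EE'.
Qed.

(** The simple approximations of [f] from below share its bound, so both functionals pass to the
    limit along them. *)
Lemma bexp_ge0_unique f : bmeas f -> (forall x, 0 <= f x) -> E f = E' f.
Proof.
move=> bf f0; have [mf [M fM]] := bf.
have mEf : measurable_fun setT (EFin \o f) by exact/measurable_EFinP.
have f0' x : setT x -> (0 <= (EFin \o f) x)%E by rewrite lee_fin.
pose g n := nnsfun_approx measurableT mEf n.
have gf n x : g n x <= f x.
  by rewrite -lee_fin /g nnsfun_approxE; exact: le_approx.
have bg n : bmeas (g n).
  split; first exact: measurable_funPT.
  by exists M => x; rewrite ger0_norm// (le_trans (gf n x))// (le_trans
    (ler_norm _)).
have gM n x : `|g n x| <= M.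
  by rewrite ger0_norm// (le_trans (gf n x))// (le_trans (ler_norm _)).
have gcvg x : g ^~ x @ \oo --> f x.
  by have /(_ x I)/fine_cvgP[] := cvg_nnsfun_approx measurableT mEf f0'.
have c1 := bexp_cvg HE bg bf gM gcvg.
have c2 := bexp_cvg HE' bg bf gM gcvg.
rewrite (_ : (fun n => E (g n)) = (fun n => E' (g n))) in c1.
  exact: (cvg_unique _ c1 c2).
by apply/funext => n; exact: bexp_nnsfun_unique.
Qed.

Lemma bexp_unique f : bmeas f -> E f = E' f.
Proof.
move=> bf; have [mf [M fM]] := bf.
(* Adding the bound [M] makes [f] nonnegative; both functionals send the constant to [M]. *)
have bfM : bmeas (fun x => f x + cst M x) by apply: bmeasD => //;
  exact: bmeas_cst.
have := @bexp_ge0_unique _ bfM.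
rewrite (bexpD HE bf (bmeas_cst _ M)) (bexpD HE' bf (bmeas_cst _ M)).
rewrite !bexp_cst// => /(_ _)/addIr; apply=> x /=.
by rewrite -lerBlDr sub0r lerNl (le_trans _ (fM x))// ler_normr lexx orbT.
Qed.

End BexpUnique.

(** * Representation of a functional by a probability measure *)

Section Daniell.
Context d (T : measurableType d) (R : realType).
Variables (E : (T -> R) -> R) (HE : bexp E).

(* The absolute value only serves to keep the junk values on non-measurable
   sets nonnegative; the unused argument of type [bexp E] lets the measure
   instance below be found. *)
Definition daniell of bexp E := fun A : set T => (`|E (\1_A)|)%:E.
Local Notation mu := (daniell HE).

Lemma daniellE A : measurable A -> mu A = (E (\1_A))%:E.
Proof.
move=> mA; rewrite /daniell ger0_norm//; apply: (bexp_ge0 HE) => //.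
exact: bmeas_indic.
Qed.

Let daniell0 : mu set0 = 0%E.
Proof. by rewrite daniellE// indic0 (bexp_cst HE). Qed.

Let daniell_ge0 A : (0 <= mu A)%E.
Proof. by rewrite lee_fin. Qed.

(** The partial sums of the indicators of disjoint sets are bounded by 1 and converge pointwise to
    the indicator of the union, so Daniell continuity applies. *)
Let daniell_sigma_additive : semi_sigma_additive mu.
Proof.
move=> F mF tF mUF; rewrite daniellE//.
pose S n x : R := \sum_(0 <= i < n) \1_(F i) x.
rewrite (_ : (fun n => _) = (fun n => (E (S n))%:E)); last first.
  apply/funext => n; rewrite (bexp_sum HE)//; last by move=> i;
    exact: bmeas_indic.
  by rewrite -sumEFin; apply: eq_bigr => i _; rewrite daniellE.
have F0 x n : true -> (0 <= (\1_(F n) x : R)%:E)%E by rewrite lee_fin.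
apply: cvg_EFin; first by apply: nearW.
apply: (bexp_cvg HE (M := 1)).
- by move=> n; apply: bmeas_sum => i; exact: bmeas_indic.
- exact: bmeas_indic.
- move=> n x; rewrite ger0_norm; last by rewrite sumr_ge0.
  rewrite -lee_fin -sumEFin.
  apply: (le_trans (nneseries_lim_ge n (fun k _ => F0 x k))).
  by rewrite -indic_bigcup// lee_fin indicE; case: (_ \in _).
- move=> x; suff /fine_cvgP[_] : (EFin \o S ^~ x) @ \oo --> (\1_(\bigcup_n F n)
    x)%:E by [].
  rewrite indic_bigcup//.
  rewrite (_ : EFin \o _ = fun n => (\sum_(0 <= i < n) (\1_(F i) x)%:E)%E).
    by apply: is_cvg_nneseries => n _ _; exact: F0.
  by apply/funext => n; rewrite /= sumEFin.
Qed.

HB.instance Definition _ := isMeasure.Build _ _ _ mu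
  daniell0 daniell_ge0 daniell_sigma_additive.

Let daniellT : mu setT = 1%E.
Proof. by rewrite daniellE// indicT (bexp1 HE). Qed.

HB.instance Definition _ := @Measure_isProbability.Build _ _ R mu daniellT.

Theorem bexp_representation :
  exists P : probability T R, forall f, bmeas f -> E f = Rintegral P setT f.
Proof.
exists mu; apply: bexp_unique => //; first exact: bexp_Rintegral.
move=> A mA; rewrite /Rintegral integral_indic// setIT.
by rewrite [X in fine X]daniellE.
Qed.

End Daniell.

(** * Images under measurable maps and product probabilities *)

Lemma bmeas_comp d d' (T : measurableType d) (T' : measurableType d')
    (R : realType) (f : T' -> R) (g : T -> T') :
  measurable_fun setT g -> bmeas f -> bmeas (f \o g).
Proof.
move=> mg [mf [M fM]]; split; first exact: measurableT_comp.
by exists M => x /=.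
Qed.

(** The functional counterpart of the image of a measure under [g]. *)
Lemma bexp_comp d d' (T : measurableType d) (T' : measurableType d')
    (R : realType) (E : (T -> R) -> R) (g : T -> T') :
  measurable_fun setT g -> bexp E -> bexp (fun f => E (f \o g)).
Proof.
move=> mg HE; split.
- by move=> f h bf bh; rewrite (bexpD HE)//; exact: bmeas_comp.
- by move=> c f bf; rewrite (bexpZ HE)//; exact: bmeas_comp.
- by move=> f bf f0; apply: (bexp_ge0 HE) => //=; exact: bmeas_comp.
- exact: (bexp1 HE).
- move=> f_ M bf fM f0; apply: (bexp_cvg0 HE (M := M)) => //= n.
  exact: bmeas_comp.
Qed.

Section ProductProbability.
Context d1 d2 (T1 : measurableType d1) (T2 : measurableType d2) (R : realType).
Variables (P1 : probability T1 R) (P2 : probability T2 R).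

(** Tonelli gives measurability of the partial integral of a nonnegative function; it is applied to
    [f + M], and [M] is subtracted afterwards. *)
Lemma bmeas_Rintegral (f : T1 * T2 -> R) : bmeas f ->
  bmeas (fun x => Rintegral P2 setT (fun y => f (x, y))).
Proof.
move=> bf; have [mf [M fM]] := bf.
have bfx x : bmeas (fun y => f (x, y)).
  by apply: (@bmeas_comp _ _ _ _ _ f (fun y => (x, y))) => //;
    exact: measurable_pair1.
split; last by exists M => x; exact: (bexp_norm (bexp_Rintegral P2)).
pose g x := Rintegral P2 setT (fun y => f (x, y) + cst M y).
rewrite (_ : (fun x => _) = (fun x => g x - M)); last first.
  apply/funext => x; rewrite /g (bexpD (bexp_Rintegral P2))//;
    last exact: bmeas_cst.
  by rewrite (bexp_cst (bexp_Rintegral P2)) addrK.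
apply: measurable_funB => //.
apply: measurableT_comp => //.
apply: (@measurable_fun_fubini_tonelli_F _ _ _ _ _ P2 (fun p => (f p + M)%:E)).
  by apply/measurable_EFinP; exact: measurable_funD.
by move=> p; rewrite lee_fin -lerBlDr sub0r lerNl (le_trans _ (fM p))//
  ler_normr lexx orbT.
Qed.

Lemma Rintegral_prod (f : T1 * T2 -> R) : bmeas f ->
  Rintegral (P1 \x P2)%E setT f =
  Rintegral P1 setT (fun x => Rintegral P2 setT (fun y => f (x, y))).
Proof.
move=> bf; have := bmeas_integrable (P1 \x P2)%E bf.
move=> /integral12_prod_meas1; rewrite /Rintegral => <-.
congr fine; apply: eq_integral => x _; rewrite /fubini_F fineK//.
apply: (integrable_fin_num measurableT).
apply: bmeas_integrable.
by apply: (@bmeas_comp _ _ _ _ _ f (fun y => (x, y))) => //;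
  exact: measurable_pair1.
Qed.

End ProductProbability.

(** * Functionals given by a probability density *)

Section Density.
Context d (T : measurableType d) (R : realType) (mu : {measure set T -> \bar
  R}).
Variable (p : T -> R).
Hypotheses (ip : mu.-integrable setT (EFin \o p)) (p0 : forall x, 0 <= p x)
  (p1 : Rintegral mu setT p = 1).

Lemma bmeas_density_integrable f : bmeas f ->
  mu.-integrable setT (EFin \o (fun x => f x * p x)).
Proof.
move=> [mf [M fM]]; apply: (@le_integrable _ _ _ mu setT _ _ (EFin \o (fun x =>
  M * p x))) => //.
- by apply/measurable_EFinP; apply: measurable_funM => //;
    exact/measurable_EFinP/(measurable_int mu).
- move=> x _ /=; rewrite lee_fin !normrM ler_wpM2r//.
  by rewrite (le_trans (fM x))// ler_norm.
- rewrite (_ : _ \o _ = (fun x => M%:E * (p x)%:E)%E).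
    exact: integrableZl.
  by apply/funext => x /=; rewrite EFinM.
Qed.

Lemma bexp_density : bexp (fun f => Rintegral mu setT (fun x => f x * p x)).
Proof.
split.
- move=> f g bf bg; rewrite -RintegralD//; try exact: bmeas_density_integrable.
  by apply: eq_Rintegral => x _; rewrite mulrDl.
- move=> c f bf; rewrite -RintegralZl//; try exact: bmeas_density_integrable.
  by apply: eq_Rintegral => x _; rewrite mulrA.
- by move=> f _ f0; apply: Rintegral_ge0 => x _; rewrite mulr_ge0.
- by rewrite -[RHS]p1; apply: eq_Rintegral => x _; rewrite mul1r.
- move=> f_ M bf fM f0.
  have ig : mu.-integrable setT (EFin \o (fun x => cst M x * p x)).
    by apply: bmeas_density_integrable; exact: bmeas_cst.
  have [||||_ _] := @dominated_convergence _ _ _ mu setT measurableT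
      (fun n => EFin \o (fun x => f_ n x * p x)) (cst 0%E) _ _ _ _ ig.
  + by move=> n; exact: (measurable_int mu (bmeas_density_integrable (bf n))).
  + exact: measurable_cst.
  + apply: aeW => x _; apply/fine_cvgP; split; first by apply: nearW.
    rewrite -[X in _ --> X](mul0r (p x)); apply: cvgMr_tmp; exact: f0.
  + by apply: aeW => x n _; rewrite /= lee_fin normrM ler_pM// ger0_norm.
  by rewrite integral0 => /fine_cvgP[].
Qed.

End Density.

(** * Affine change of variables for Lebesgue measure *)

Section Affine.
Variables (R : realType) (r s : R) (s0 : 0 < s).
Local Notation leb := (@lebesgue_measure R).
Let aff (z : measurableTypeR R) : measurableTypeR R := r + s * z.

Let measurable_aff : measurable_fun setT aff.
Proof. by apply: measurable_funD => //; exact: measurable_funM. Qed.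

Let image_leb : {measure set (measurableTypeR R) -> \bar R} :=
  measure_function_pushforward__canonical__measure_function_Measure leb
    measurable_aff.

(** By uniqueness of Lebesgue measure it is enough to compare half-open intervals, whose preimages
    under [aff] are shorter by the factor [s]. *)
Lemma lebesgue_measure_affine (A : set R) : measurable A ->
  leb A = mscale (NngNum (ltW s0)) image_leb A.
Proof.
move=> mA; apply: lebesgue_measure_unique => //= _ [[a b]] _ <-.
rewrite /mscale /= /image_leb /= /pushforward.
have -> : aff @^-1` `]a, b] = `](a - r) / s, (b - r) / s]%classic.
  apply/seteqP; split => z /=; rewrite !in_itv/= /aff.
    by rewrite ltr_pdivrMr// ler_pdivlMr// ltrBlDl lerBrDl mulrC.
  by rewrite ltr_pdivrMr// ler_pdivlMr// ltrBlDl lerBrDl mulrC.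
rewrite !lebesgue_measure_itv/= !lte_fin ltr_pM2r ?invr_gt0// ltrD2r.
case: ifPn => _; last by rewrite mule0.
rewrite -!EFinB -EFinM -mulrBl opprB addrA subrK.
by rewrite mulrC divfK// gt_eqF.
Qed.

Lemma ge0_integral_affine (f : R -> \bar R) :
  measurable_fun setT f -> (forall x, 0 <= f x)%E ->
  (\int[leb]_x f x = s%:E * \int[leb]_z f (r + s * z)%R)%E.
Proof.
move=> mf f0.
rewrite (eq_measure_integral (mscale (NngNum (ltW s0)) image_leb)); last first.
  by move=> A mA _; exact: lebesgue_measure_affine.
rewrite ge0_integral_mscale//=; congr (_ * _)%E.
by rewrite ge0_integral_pushforward.
Qed.

End Affine.

(** * Minorization of a periodized Gaussian by the uniform law *)

Section GaussUniform.
Variable R : realType.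
Local Notation leb := (@lebesgue_measure R).

Lemma Rintegral_density d (T : measurableType d) (mu : {measure set T -> \bar
  R})
    (P : probability T R) (p : T -> R) :
  mu.-integrable setT (EFin \o p) -> (forall x, 0 <= p x) ->
  (forall A, measurable A -> P A = \int[mu]_(x in A) (p x)%:E)%E ->
  forall f, bmeas f ->
    Rintegral P setT f = Rintegral mu setT (fun x => f x * p x).
Proof.
move=> ip p0 Pp f bf; have p1 : Rintegral mu setT p = 1.
  by rewrite /Rintegral -Pp// probability_setT.
apply: (bexp_unique (bexp_Rintegral P) (bexp_density ip p0 p1)) => // A mA.
rewrite /Rintegral integral_indic// setIT; congr fine;
  apply: (etrans (Pp _ mA)).
rewrite integral_mkcond; apply: eq_integral => x _.
by rewrite patchE indicE; case: ifPn; rewrite ?mul1r ?mul0r.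
Qed.

Lemma gaussE (z : R) : gauss z = normal_pdf 0 1 z.
Proof.
rewrite normal_pdfE ?oner_eq0// /gauss /normal_peak /normal_fun mulrC.
by rewrite expr1n mul1r subr0 mulr_natl.
Qed.

Lemma Rint_gauss (f : R -> R) : bmeas f ->
  Defs.Rint (fun z => f z * gauss z) = Rintegral (normal_prob 0 1) setT f.
Proof.
move=> bf; rewrite (Rintegral_density (integrable_normal_pdf 0 1))//;
  last first.
  exact: normal_pdf_ge0.
by apply: eq_Rintegral => x _; rewrite gaussE.
Qed.

Lemma gauss_ge0 (z : R) : 0 <= gauss z.
Proof. by rewrite gaussE normal_pdf_ge0. Qed.

Lemma gauss_gt0 (z : R) : 0 < gauss z.
Proof. by rewrite divr_gt0 ?expR_gt0// sqrtr_gt0 mulr_gt0// pi_gt0. Qed.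

Lemma le_gauss (a z : R) : `|z| <= a -> gauss a <= gauss z.
Proof.
move=> za; rewrite ler_wpM2r ?invr_ge0 ?sqrtr_ge0// ler_expR ler_wpM2r
  ?invr_ge0//.
by rewrite lerN2 -(real_normK (num_real z)) lerXn2r// nnegrE (le_trans _ za).
Qed.

Definition per1 (f : R -> R) := forall x, f (x + 1) = f x.

Lemma per1_int f x (n : int) : per1 f -> f (x + n%:~R) = f x.
Proof.
move=> pf; have pn k y : f (y + k%:R) = f y.
  by elim: k y => [|k IH] y; rewrite ?addr0// -natr1 addrA pf IH.
case: n => n; first by rewrite -pmulrn pn.
by rewrite NegzE mulrNz -pmulrn -[in RHS](subrK n.+1%:R x) pn.
Qed.

Definition fpart (x : R) : R := x - (Num.floor x)%:~R.

Lemma per1_frac f x : per1 f -> f (fpart x) = f x.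
Proof. by move=> pf; rewrite /fpart -mulrNz per1_int. Qed.

Lemma fracD1 : per1 fpart.
Proof. by move=> x; rewrite /fpart floorDrz// ?floor1 ?intrD; lra. Qed.

Lemma frac_itv x : 0 <= fpart x < 1.
Proof.
by rewrite /fpart subr_ge0 ltrBlDl -[1]/(1%:~R) -intrD floor_itv.
Qed.

Lemma measurable_frac : measurable_fun setT fpart.
Proof.
apply: measurable_funB => //; apply: nondecreasing_measurable => // x y xy.
by rewrite ler_int le_floor.
Qed.

(** By periodicity the centre may be taken in [[0, 1)]. Then [r + s * z] in [[0, 1]] forces
    [|z| <= 1 / s], where the Gaussian density is at least [gauss s^-1]; the substitution
    [x = r + s * z] supplies the other factor [1 / s]. The constant is thus independent of [m]. *)
Lemma gauss_minorization (s : R) : 0 < s -> exists2 c : R, 0 < c &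
  forall (f : R -> R) m, bmeas f -> (forall x, 0 <= f x) -> per1 f ->
    c * Rintegral (uniform_prob (@ltr01 R)) setT f <=
    Rintegral (normal_prob 0 1) setT (fun z => f (m + s * z)).
Proof.
move=> s0; exists (gauss s^-1 / s); first by rewrite divr_gt0// gauss_gt0.
move=> f m bf f0 pf.
rewrite (_ : (fun z => f (m + s * z)) = (fun z => f (fpart m + s * z)));
  last first.
  apply/funext => z; rewrite -[in RHS](@per1_int f _ (Num.floor m))// addrAC.
  by rewrite /fpart subrK.
set r := fpart m; have /andP[r0 r1] : 0 <= r < 1 by exact: frac_itv.
have mF : measurable_fun setT (fun z : measurableTypeR R => r + s * z :
  measurableTypeR R).
  by apply: measurable_funD => //; exact: measurable_funM.
have bF : bmeas (fun z => f (r + s * z)) by exact: (bmeas_comp mF).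
have [mf _] := bf.
pose u := uniform_pdf (0 : R) 1.
have u0 x : 0 <= u x by exact: uniform_pdf_ge0.
have mu : measurable_fun setT u by exact: measurable_uniform_pdf.
have iG : leb.-integrable setT (EFin \o (fun z => f (r + s * z) * gauss z)).
  rewrite (_ : (fun z => _) = (fun z => f (r + s * z) * normal_pdf 0 1 z)).
    exact: (bmeas_density_integrable (integrable_normal_pdf 0 1) bF).
  by apply/funext => z; rewrite gaussE.
(* [h] keeps only the part of the integrand where [r + s * z] falls in the unit interval, the
   support of [u]. *)
pose h z := f (r + s * z) * u (r + s * z).
have mh : measurable_fun setT h.
  by apply: measurable_funM; [exact: bF.1|exact: measurableT_comp mu mF].
have hG z : gauss s^-1 * h z <= f (r + s * z) * gauss z.
  rewrite mulrCA ler_wpM2l// /u /uniform_pdf; case: ifPn => [/andP[z0 z1]|_];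
    last first.
    by rewrite mulr0 gauss_ge0.
  rewrite subr0 invr1 mulr1 le_gauss// -[leRHS]mul1r ler_pdivlMr// -[X in _ *
    X]gtr0_norm//.
  by rewrite -normrM ler_norml; apply/andP; split; lra.
have iH : leb.-integrable setT (EFin \o h).
  rewrite (_ : _ \o _ = (fun z => (gauss s^-1)^-1%:E * (gauss s^-1 * h
    z)%:E)%E); last first.
    by apply/funext => z; rewrite -EFinM mulKf// gt_eqF// gauss_gt0.
  apply: integrableZl => //; apply: le_integrable iG => //.
    by apply/measurable_EFinP; exact: measurable_funM.
  move=> z _ /=; rewrite lee_fin !ger0_norm ?hG// mulr_ge0 ?gauss_ge0//.
  by rewrite mulr_ge0.
rewrite (Rintegral_density (integrable_uniform_pdf (@ltr01 R)))//.
rewrite -[leRHS]Rint_gauss//.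
apply: (@le_trans _ _ (Rintegral leb setT (fun z => gauss s^-1 * h z)));
  last first.
  apply: le_Rintegral => //; apply: le_integrable iG => //.
    by apply/measurable_EFinP; exact: measurable_funM.
  move=> z _ /=; rewrite lee_fin !ger0_norm ?hG// mulr_ge0 ?gauss_ge0//.
  by rewrite mulr_ge0.
rewrite RintegralZl// -mulrA ler_wpM2l ?gauss_ge0//.
(* The Jacobian [s] cancels the [s^-1] in the constant. *)
rewrite /Rintegral (ge0_integral_affine r s0); last 2 first.
  by apply/measurable_EFinP; exact: measurable_funM.
  by move=> x; rewrite lee_fin mulr_ge0.
rewrite fineM//; last exact: (integrable_fin_num measurableT iH).
by rewrite /= mulKf// gt_eqF.
Qed.

End GaussUniform.

(** * Markov operators and contraction of oscillation *)

Section Markov.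
Context d (T : measurableType d) (R : realType).
Implicit Types (P Q : (T -> R) -> T -> R) (f : T -> R).

Definition markov_op P :=
  (forall x, bexp (fun f => P f x)) /\ (forall f, bmeas f -> bmeas (P f)).

Lemma markov_id : markov_op id.
Proof.
by split=> // x; split.
Qed.

Lemma markov_comp P Q : markov_op P -> markov_op Q -> markov_op (P \o Q).
Proof.
move=> [EP bP] [EQ bQ]; split=> [x|f bf]; last exact/bP/bQ.
split => /=.
- move=> f g bf bg; rewrite -(bexpD (EP x)); try exact: bQ.
  by congr (P _ x); apply/funext => y; rewrite (bexpD (EQ y)).
- move=> c f bf; rewrite -(bexpZ (EP x)); last exact: bQ.
  by congr (P _ x); apply/funext => y; rewrite (bexpZ (EQ y)).
- move=> f bf f0; apply: (bexp_ge0 (EP x)); first exact: bQ.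
  by move=> y; exact: (bexp_ge0 (EQ y)).
- rewrite -[RHS](bexp1 (EP x)).
  by congr (P _ x); apply/funext => y; rewrite (bexp1 (EQ y)).
- move=> f_ M bf fM f0; apply: (bexp_cvg0 (EP x) (M := M)).
  + by move=> n; exact: bQ.
  + by move=> n y; exact: (bexp_norm (EQ y)).
  + by move=> y; exact: (bexp_cvg0 (EQ y) bf fM f0).
Qed.

Lemma markov_iter P n : markov_op P -> markov_op (iter n P).
Proof.
move=> mP; elim: n => [|n IH]; first exact: markov_id.
exact: (markov_comp mP IH).
Qed.

(** Oscillation at most [D], witnessed by an enclosing interval so that no supremum or infimum has
    to be handled. *)
Definition oscle (D : R) f := exists a, forall x, a <= f x <= a + D.

Lemma oscle_bound (M : R) f : (forall x, `|f x| <= M) -> oscle (2 * M) f.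
Proof.
move=> fM; exists (- M) => x; have := fM x;
  rewrite ler_norml => /andP[-> /le_trans->//].
lra.
Qed.

(* Doeblin: if the law of one step dominates [eps] times a fixed probability,
   then oscillations shrink by the factor [1 - eps]. *)
Lemma doeblin_oscle P (nu : (T -> R) -> R) (eps D : R) f :
  markov_op P -> bexp nu -> bmeas f ->
  (forall a b, (forall x, 0 <= a + b * f x) ->
     forall x, eps * nu (fun y => a + b * f y) <= P (fun y => a + b * f y) x) ->
  oscle D f -> oscle ((1 - eps) * D) (P f).
Proof.
move=> [EP bP] hnu bf minor [a fa].
have lin E : bexp E -> forall c k, E (fun y => c + k * f y) = c + k * E f.
  move=> HE c k; rewrite (bexpD HE (f := cst c) (g := fun y => k * f y)).
  - by rewrite (bexp_cst HE) (bexpZ HE).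
  - exact: bmeas_cst.
  - exact: bmeasZ.
(* The minorization is applied to the two nonnegative functions [f - a] and [a + D - f]; they give
   the lower and the upper end of the new interval. *)
exists (a + eps * (nu f - a)) => x.
have linP c k : P (fun y => c + k * f y) x = c + k * P f x := lin _ (EP x) c k.
have h1 : eps * (- a + 1 * nu f) <= - a + 1 * P f x.
  rewrite -(lin _ hnu) -linP; apply: minor => y.
  by rewrite mul1r addrC subr_ge0; case/andP: (fa y).
have h2 : eps * (a + D + -1 * nu f) <= a + D + -1 * P f x.
  rewrite -(lin _ hnu) -linP; apply: minor => y.
  by rewrite mulN1r subr_ge0; case/andP: (fa y).
apply/andP; split; lra.
Qed.

End Markov.

(** * Minorization in the plane *)

Section Plane.
Variable R : realType.
Local Notation G := (normal_prob (0 : R) 1).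
Local Notation U := (uniform_prob (@ltr01 R)).
Local Notation RR := (R * R)%type.

Definition per2 (f : RR -> R) := forall x1 x2,
  f (x1 + 1, x2) = f (x1, x2) /\ f (x1, x2 + 1) = f (x1, x2).

Definition shift2 (s : R) (m w : RR) : RR := (m.1 + s * w.1, m.2 + s * w.2).

Lemma measurable_shift2 s : measurable_fun setT (fun p : RR * RR => shift2 s
  p.1 p.2).
Proof.
apply/measurable_fun_pairP; split => /=.
  apply: measurable_funD; first exact: measurableT_comp.
  by apply: measurable_funM => //; exact: measurableT_comp.
apply: measurable_funD; first exact: measurableT_comp.
by apply: measurable_funM => //; exact: measurableT_comp.
Qed.

Lemma measurable_shift2r s m : measurable_fun setT (shift2 s m).
Proof.
rewrite (_ : shift2 s m = (fun p : RR * RR => shift2 s p.1 p.2) \o pair m)//.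
by apply: measurableT_comp; [exact: measurable_shift2|exact: measurable_pair1].
Qed.

(** Fubini reduces this to two uses of the one-dimensional bound: on the partial integral [h], which
    is again periodic, and on each slice with the first coordinate fixed. *)
Lemma gauss2_minorization (s : R) : 0 < s -> exists2 eps : R, 0 < eps < 1 &
  forall (f : RR -> R) m, bmeas f -> (forall x, 0 <= f x) -> per2 f ->
    eps * Rintegral (U \x U)%E setT f <=
    Rintegral (G \x G)%E setT (fun w => f (shift2 s m w)).
Proof.
move=> s0; have [c c0 hc] := gauss_minorization s0.
(* The cap [2^-1] ensures [eps < 1], hence a positive contraction factor. *)
exists (Num.min (c * c) 2^-1).
  by rewrite lt_min mulr_gt0// invr_gt0 ltr0n/= gt_min invf_lt1 ?ltr1n ?orbT.
move=> f m bf f0 pf.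
apply: (@le_trans _ _ (c * c * Rintegral (U \x U)%E setT f)).
  by rewrite ler_wpM2r ?ge_min ?lexx//; exact: Rintegral_ge0.
rewrite !Rintegral_prod//; last exact: (bmeas_comp (measurable_shift2r s m)).
have bf2 y : bmeas (fun z => f (y, z)).
  by apply: (@bmeas_comp _ _ _ _ _ f (fun z => (y, z))) => //;
    exact: measurable_pair1.
pose h u := Rintegral U setT (fun v => f (u, v)).
have bh : bmeas h by exact: bmeas_Rintegral.
have h0 u : 0 <= h u by exact: Rintegral_ge0.
have ph : per1 h.
  by move=> u; apply: eq_Rintegral => v _; have [] := pf u v.
rewrite -mulrA; apply: (le_trans (ler_wpM2l (ltW c0) (hc h m.1 bh h0 ph))).
have mF (r : R) : measurable_fun setT (fun z : measurableTypeR R => r + s * z :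
  measurableTypeR R).
  by apply: measurable_funD => //; exact: measurable_funM.
have bhs : bmeas (fun z => h (m.1 + s * z)) by exact: (bmeas_comp (mF m.1)).
rewrite -RintegralZl//; last exact: bmeas_integrable.
apply: (bexp_le (bexp_Rintegral G)).
- exact: bmeasZ.
- apply: (@bmeas_Rintegral _ _ _ _ R G (fun p => f (shift2 s m p))).
  exact: (bmeas_comp (measurable_shift2r s m)).
- move=> z /=; rewrite /shift2 /= ; apply: hc => //.
  by move=> v; have [] := pf (m.1 + s * z) v.
Qed.

End Plane.

(** * Convergence by comparison with a geometric sequence *)

Section GeometricLimits.
Variable R : realType.

Lemma geometric_series_cvg (u : R ^nat) (C q : R) : 0 <= q < 1 ->
  (forall k, `|u k| <= C * q ^+ k) -> cvgn (series u).
Proof.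
move=> /andP[q0 q1] uC; apply: normed_cvg.
apply: (@series_le_cvg _ (fun k => `|u k|) (geometric C q)) => //.
- by move=> k; apply: le_trans (uC k).
- by apply: is_cvg_geometric_series; rewrite ger0_norm.
Qed.

Lemma geometric_cvg (u : R ^nat) (C q : R) : 0 <= q < 1 ->
  (forall k, `|u k.+1 - u k| <= C * q ^+ k) -> cvgn u.
Proof.
move=> hq uC; have := geometric_series_cvg (u := telescope u) hq uC.
move=> ct; rewrite (_ : u = (fun n => u 0%N + series (telescope u) n)).
  by apply: is_cvgD => //; exact: is_cvg_cst.
by apply/funext => n; exact: eq_sum_telescope.
Qed.

End GeometricLimits.

(** * Limits of functionals that are uniform on bounded sets *)

Section BexpLimit.
Context d (T : measurableType d) (R : realType).
Variables (E_ : nat -> (T -> R) -> R) (r : nat -> R).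
Hypotheses (HE : forall n, bexp (E_ n)) (r0 : r @ \oo --> 0).
Hypothesis Ecvg : forall f, bmeas f -> cvgn (E_ ^~ f).
Hypothesis Eunif : forall f M n k, bmeas f -> (forall x, `|f x| <= M) ->
  `|E_ (n + k)%N f - E_ n f| <= r n * M.

Let E f := limn (E_ ^~ f).

Let EP f : bmeas f -> E_ n f @[n --> \oo] --> E f.
Proof. exact: Ecvg. Qed.

(** Let [k] tend to infinity in [Eunif]. *)
Let E_le f M n : bmeas f -> (forall x, `|f x| <= M) -> `|E f - E_ n f| <= r n *
  M.
Proof.
move=> bf fM; have : `|E_ (k + n)%N f - E_ n f| @[k --> \oo] --> `|E f - E_ n
  f|.
  by apply: cvg_norm; apply: cvgB; [rewrite (cvg_shiftn n (E_ ^~ f));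
    exact: EP|exact: cvg_cst].
move=> c; rewrite -(cvg_lim (@Rhausdorff R) c).
apply: limr_le; first by apply: cvgP c.
by apply: nearW => k; rewrite addnC; exact: Eunif.
Qed.

Lemma bexp_lim : bexp (fun f => limn (E_ ^~ f)).
Proof.
split.
- move=> f g bf bg; apply: cvg_lim => //.
  rewrite (_ : (fun n => _) = (fun n => E_ n f + E_ n g)).
    by apply: cvgD; exact: EP.
  by apply/funext => n; rewrite (bexpD (HE n)).
- move=> c f bf; apply: cvg_lim => //.
  rewrite (_ : (fun n => _) = (fun n => c * E_ n f)).
    by apply: cvgMl_tmp; exact: EP.
  by apply/funext => n; rewrite (bexpZ (HE n)).
- move=> f bf f0; apply: limr_ge; first exact: Ecvg.
  by apply: nearW => n; exact: (bexp_ge0 (HE n)).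
- apply: cvg_lim => //; rewrite (_ : (fun n => _) = cst 1);
    first exact: cvg_cst.
  by apply/funext => n; rewrite (bexp1 (HE n)).
- move=> f_ M bf fM f0; apply/cvgrPdist_lt => e e0.
  have e20 : 0 < e / 2 by rewrite divr_gt0.
  (* An interchange of limits: [n] is fixed first, making [E_ n] close to [E] simultaneously on all
     [f_ k]; the continuity of that single [E_ n] then does the rest. *)
  have [n rn] : exists n, r n * M < e / 2.
    have : r n * M @[n --> \oo] --> 0 by rewrite -[X in _ --> X](mul0r M);
      exact: cvgMr_tmp.
    move=> /cvgrPdist_lt/(_ _ e20)[n _ /(_ n (leqnn n))] /=.
    by rewrite sub0r normrN => /(le_lt_trans (ler_norm _)); exists n.
  have := bexp_cvg0 (HE n) bf fM f0 => /cvgrPdist_lt/(_ _ e20).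
  apply: filterS => k; rewrite !sub0r !normrN => Ek.
  rewrite -[X in `|X|](subrK (E_ n (f_ k))) (le_lt_trans (ler_normD _ _))//.
  rewrite [e]splitr ltrD// (le_lt_trans _ rn)//; exact: E_le.
Qed.

End BexpLimit.

(* [lebesgue_measure] lives on [measurableTypeR R], whose display differs from
   that of the measurable structure [Defs] infers on [R]; both have the same
   measurable sets. *)
Lemma bexp_plane (R : realType) (E : (R * R -> R) -> R) :
  @bexp _ (measurableTypeR R * measurableTypeR R)%type R E ->
  @bexp _ (R * R)%type R E.
Proof. by move=> [ED EZ Ege0 E1 Ecvg0]; split. Qed.

(** * The numerical scheme: contraction, invariant measures and decay *)

Section Scheme.
Variables (R : realType) (sigma : R) (v1 v2 : R -> R -> R) (N : nat).
Hypotheses (hsigma : 0 < sigma) (hN : (0 < N)%N).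
Hypotheses (mv1 : forall t, measurable_fun setT (v1 t))
  (mv2 : forall t, measurable_fun setT (v2 t)).
Hypotheses (hv1p : forall t y, v1 (t + 1) y = v1 t y /\ v1 t (y + 1) = v1 t y)
  (hv2p : forall t y, v2 (t + 1) y = v2 t y /\ v2 t (y + 1) = v2 t y).
Local Notation RR := (R * R)%type.
Local Notation G := (normal_prob (0 : R) 1).
Local Notation U := (uniform_prob (@ltr01 R)).
Local Notation I := (one_step N sigma v1 v2).

Let dt : R := N%:R^-1.
Let noise : R := sigma * Num.sqrt dt.

Let noise_gt0 : 0 < noise.
Proof. by rewrite mulr_gt0// sqrtr_gt0 invr_gt0 ltr0n. Qed.

Definition drift (t : R) (x : RR) : RR :=
  let th := t + dt / 2 in
  let y1 := x.1 + v1 th x.2 * dt in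
  (y1, x.2 + v2 th y1 * dt).

(** One step acting on a single time slice, with time as a parameter. The noise is written as a
    product law instead of iterated density integrals, so that the theory of [bexp] applies. *)
Definition step (t : R) (f : RR -> R) (x : RR) : R :=
  Rintegral (G \x G)%E setT (fun w => f (shift2 noise (drift t x) w)).

Lemma measurable_drift t : measurable_fun setT (drift t).
Proof.
have m1 : measurable_fun setT (fun x : RR => x.1 + v1 (t + dt / 2) x.2 * dt).
  apply: measurable_funD => //; apply: measurable_funM => //.
  exact: (measurableT_comp (mv1 _)).
apply/measurable_fun_pairP; split => //=.
apply: measurable_funD => //; apply: measurable_funM => //.
exact: (measurableT_comp (mv2 _)).
Qed.

Lemma one_stepE phi t : bmeas (phi (t + dt)) -> I phi t = step t (phi (t + dt)).
Proof.
move=> bphi; apply/funext => x; rewrite /one_step /step -/dt -/noise.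
set m1 := x.1 + _ * dt; set m2 := x.2 + _ * dt.
rewrite (_ : drift t x = (m1, m2))//.
have bF := bmeas_comp (measurable_shift2r noise (m1, m2)) bphi.
rewrite Rintegral_prod//.
have bF2 z1 : bmeas (fun z2 => phi (t + dt) (m1 + noise * z1, m2 + noise * z2)).
  apply: (@bmeas_comp _ _ _ _ _ (fun w => phi (t + dt) (shift2 noise (m1, m2)
    w)) (pair z1)) => //.
rewrite -[RHS](Rint_gauss (bmeas_Rintegral G bF)).
rewrite /Defs.Rint; apply: eq_Rintegral => z1 _.
rewrite -/(Defs.Rint _) Rint_gauss; last first.
  by under eq_fun do rewrite mulrC; exact: bmeasZ.
rewrite RintegralZr//.
exact: (@bmeas_integrable _ (measurableTypeR R) R (normal_prob 0 1) _ (bF2 z1)).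
Qed.

Lemma markov_step t : markov_op (step t).
Proof.
split.
- move=> x.
  exact: (bexp_comp (measurable_shift2r noise (drift t x))
    (bexp_plane (bexp_Rintegral (G \x G)%E))).
- move=> f bf.
  apply: (@bmeas_Rintegral _ _ _ _ R (G \x G)%E (fun p => f (shift2 noise
    (drift t p.1) p.2))).
  apply: (@bmeas_comp _ _ _ _ _ f (fun p : RR * RR => shift2 noise (drift t
    p.1) p.2)) => //.
  rewrite (_ : (fun p => _) = (fun p : RR * RR => shift2 noise p.1 p.2) \o
    (fun p => (drift t p.1, p.2)))//.
  apply: measurableT_comp; first exact: measurable_shift2.
  apply/measurable_fun_pairP; split; last exact: measurable_snd.
  by apply: (measurableT_comp (measurable_drift t)); exact: measurable_fst.
Qed.

(** Moving the start by a period moves [drift] by the same period, because [v1] and [v2] are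
    periodic in space. *)
Lemma per2_step t f : per2 f -> per2 (step t f).
Proof.
move=> pf x1 x2; split; apply: eq_Rintegral => w _; rewrite /shift2 /drift /=.
- rewrite -!(addrAC x1 _ 1) (hv2p _ _).2 -(addrAC _ _ 1).
  exact: (pf _ _).1.
- rewrite (hv1p _ _).2 -!(addrAC _ _ 1).
  exact: (pf _ _).2.
Qed.

Lemma step_timeD1 t : step (t + 1) = step t.
Proof.
apply/funext => f; apply/funext => x; apply: eq_Rintegral => w _.
by rewrite /drift -!(addrAC t _ 1) (hv1p _ _).1 (hv2p _ _).1.
Qed.

(** The minorization constant does not depend on the centre of the Gaussian, so one [q] serves all
    times and starting points. *)
Lemma step_contraction : exists2 q : R, 0 < q < 1 & forall t f D,
  bmeas f -> per2 f -> oscle D f -> oscle (q * D) (step t f).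
Proof.
have [e /andP[e0 e1] he] := gauss2_minorization noise_gt0.
exists (1 - e); first by apply/andP; split; lra.
move=> t f D bf pf; apply: (doeblin_oscle (markov_step t) (bexp_plane
  (bexp_Rintegral (U \x U)%E)) bf).
move=> a b ab x; apply: he => //.
  by apply: bmeasD; [exact: bmeas_cst|exact: bmeasZ].
by move=> x1 x2; have [-> ->] := pf x1 x2.
Qed.

(** The first step of the chain is the outermost operator, so the remaining [k'] steps start at time
    [t + dt]. *)
Fixpoint stepn (k : nat) (t : R) : (RR -> R) -> RR -> R :=
  if k is k'.+1 then step t \o stepn k' (t + dt) else id.

Lemma markov_stepn k t : markov_op (stepn k t).
Proof.
elim: k t => [|k IH] t; first exact: markov_id.
exact: (markov_comp (markov_step t) (IH _)).
Qed.

Lemma per2_stepn k t f : per2 f -> per2 (stepn k t f).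
Proof. by elim: k t => [|k IH] t pf //=; apply: per2_step; exact: IH. Qed.

Lemma stepn_timeD1 k t : stepn k (t + 1) = stepn k t.
Proof. by elim: k t => [|k IH] t //=; rewrite step_timeD1 addrAC IH. Qed.

Lemma stepn_contraction q k t f D :
  (forall t f D, bmeas f -> per2 f -> oscle D f -> oscle (q * D) (step t f)) ->
  bmeas f -> per2 f -> oscle D f -> oscle (q ^+ k * D) (stepn k t f).
Proof.
move=> hq bf pf fD; elim: k t => [|k IH] t /=; first by rewrite mul1r.
rewrite exprS -mulrA; apply: hq => //; first exact: (markov_stepn _ _).2.
exact: per2_stepn.
Qed.

(** Each application of [I] reads only the slice [dt] later, so the space-time iterate reduces to
    operators on one slice. *)
Lemma iter_one_step phi k t : (forall s, bmeas (phi s)) ->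
  iter k I phi t = stepn k t (phi (t + k%:R * dt)).
Proof.
move=> bphi; elim: k t => [|k IH] t /=; first by rewrite mul0r addr0.
rewrite one_stepE IH; last exact: (markov_stepn _ _).2.
by rewrite -addrA -[k.+1%:R]nat1r mulrDl mul1r.
Qed.

(** After [N] steps exactly one period has elapsed, so the slice that is read is the one at [t]
    itself. *)
Lemma iter_period phi t : (forall s, bmeas (phi s)) ->
  (forall s, phi (s + 1) = phi s) -> iter N I phi t = stepn N t (phi t).
Proof.
by move=> bphi pphi; rewrite iter_one_step// divff ?pphi// pnatr_eq0 -lt0n.
Qed.

Lemma iter_iter_period phi n t : (forall s, bmeas (phi s)) ->
  (forall s, phi (s + 1) = phi s) ->
  iter n (iter N I) phi t = iter n (stepn N t) (phi t).
Proof.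
move=> bphi pphi; elim: n t => [//|n IH] t /=.
rewrite iter_period; first by rewrite IH.
- by move=> s; rewrite IH; exact: (markov_iter n (markov_stepn N s)).2.
- by move=> s; rewrite !IH pphi stepn_timeD1.
Qed.

Lemma period_opE t f : bmeas f -> period_op N sigma v1 v2 t f = stepn N t f.
Proof. by move=> bf; rewrite /period_op iter_period. Qed.

Lemma per2_iter n t f : per2 f -> per2 (iter n (stepn N t) f).
Proof. by move=> pf; elim: n => //= n; exact: per2_stepn. Qed.

Lemma iter_contraction q n t f D :
  (forall t f D, bmeas f -> per2 f -> oscle D f -> oscle (q * D) (step t f)) ->
  bmeas f -> per2 f -> oscle D f -> oscle ((q ^+ N) ^+ n * D) (iter n (stepn N
    t) f).
Proof.
move=> hq bf pf fD; elim: n => [|n IH] /=; first by rewrite mul1r.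
rewrite exprS -mulrA; apply: stepn_contraction => //.
  exact: (markov_iter n (markov_stepn N t)).2.
exact: per2_iter.
Qed.

(** An average of [f] lies in every interval containing the range of [f]. *)
Lemma oscle_norm (E : (RR -> R) -> R) D f x : bexp E -> bmeas f -> oscle D f ->
  `|f x - E f| <= D.
Proof.
move=> HE bf [a fa]; have /andP[l1 u1] := fa x.
have /andP[l2 u2] := bexp_itv HE bf fa.
by rewrite ler_norml; apply/andP; split; lra.
Qed.

Lemma inv_prob_iter t (P : probability RR R) n f : inv_prob N sigma v1 v2 t P ->
  bmeas f -> per2 f ->
  Rintegral P setT (iter n (stepn N t) f) = Rintegral P setT f.
Proof.
move=> hP bf pf; elim: n => [//|n IH]; rewrite -IH /=.
have bn := (markov_iter n (markov_stepn N t)).2 _ bf.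
have := hP _ bn.1 bn.2 (per2_iter n t pf).
by rewrite period_opE.
Qed.

(** By invariance the integral of [f] is also that of its [n]-th iterate, whose oscillation has
    already shrunk by [(q ^+ N) ^+ n]. *)
Lemma period_ergodic q t (P : probability RR R) n f D x :
  (forall t f D, bmeas f -> per2 f -> oscle D f -> oscle (q * D) (step t f)) ->
  inv_prob N sigma v1 v2 t P -> bmeas f -> per2 f -> oscle D f ->
  `|iter n (stepn N t) f x - Rintegral P setT f| <= (q ^+ N) ^+ n * D.
Proof.
move=> hq hP bf pf fD; rewrite -(inv_prob_iter n hP bf pf).
apply: oscle_norm; first exact: bexp_Rintegral.
  exact: (markov_iter n (markov_stepn N t)).2.
exact: iter_contraction.
Qed.

(** Reduction to the unit square. It turns any function into a periodic one, which extends the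
    functional below from periodic functions to all bounded measurable ones. *)
Definition frac2 (x : RR) : RR := (fpart x.1, fpart x.2).

Lemma measurable_frac2 : measurable_fun setT frac2.
Proof.
by apply/measurable_fun_pairP; split;
  exact: (measurableT_comp (@measurable_frac R)).
Qed.

Lemma per2_frac2 f : per2 f -> f \o frac2 = f.
Proof.
move=> pf; apply/funext => -[x1 x2] /=; rewrite /frac2 /=.
rewrite (@per1_frac _ (fun x => f (x, fpart x2))); last by move=> x;
  case: (pf x (fpart x2)).
by rewrite (@per1_frac _ (fun y => f (x1, y)))// => y; case: (pf x1 y).
Qed.

Lemma frac2_per2 f : per2 (f \o frac2).
Proof. by move=> x1 x2; split; rewrite /= /frac2 /= fracD1. Qed.

Lemma invariant_exists t : exists P : probability RR R, inv_prob N sigma v1 v2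
  t P.
Proof.
have [q /andP[q0 q1] hq] := step_contraction.
(* The law after [n] periods of the chain started at the origin, folded back to the unit square. *)
pose E_ n f := iter n (stepn N t) (f \o frac2) ((0, 0) : RR).
pose r n := (q ^+ N) ^+ n * 2.
have hQ : 0 <= q ^+ N < 1 by rewrite exprn_ge0 ?exprn_ilt1 -?lt0n// ltW.
have /andP[Q0 Q1] := hQ.
have bfrac (f : RR -> R) : bmeas f -> bmeas (f \o frac2) by exact: (bmeas_comp
  measurable_frac2).
have HE n : bexp (E_ n).
  exact: (bexp_comp measurable_frac2 ((markov_iter n (markov_stepn N t)).1 (0,
    0))).
have Eunif (f : RR -> R) (M : R) n k : bmeas f -> (forall x, `|f x| <= M) ->
    `|E_ (n + k)%N f - E_ n f| <= r n * M.
  (* [k] further periods only average the [n]-th iterate, so the difference is at most the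
     oscillation of that iterate. *)
  move=> bf fM; rewrite distrC addnC /E_ iterD -mulrA.
  have bn := (markov_iter n (markov_stepn N t)).2 _ (bfrac _ bf).
  apply: (oscle_norm _ ((markov_iter k (markov_stepn N t)).1 (0, 0)) bn).
  apply: iter_contraction => //; [exact: bfrac|exact: frac2_per2|].
  by apply: oscle_bound => x; exact: fM.
have Ecvg f : bmeas f -> cvgn (E_ ^~ f).
  move=> bf; have [_ [M fM]] := bf.
  apply: (@geometric_cvg _ _ (2 * M) (q ^+ N)) => // k.
  by have := Eunif f M k 1%N bf fM; rewrite addn1 /r -mulrA mulrC.
have r0 : r @ \oo --> 0.
  rewrite -[X in _ --> X](mul0r 2); apply: cvgMr_tmp.
  by apply: cvg_expr; rewrite ger0_norm.
have [P EP] := bexp_representation (bexp_lim HE r0 Ecvg Eunif).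
exists P => f mf fM pf; have bf : bmeas f by [].
have bPf : bmeas (stepn N t f) := (markov_stepn N t).2 _ bf.
rewrite period_opE// -!EP//.
(* Invariance: applying the period operator to [f] shifts the sequence [E_ n f] by one index, which
   leaves its limit unchanged. *)
have c1 : (fun n => E_ (n + 1)%N f) @ \oo --> limn (E_ ^~ f).
  by rewrite (cvg_shiftn 1 (E_ ^~ f)); exact: Ecvg.
rewrite -[RHS](cvg_lim (@Rhausdorff R) c1).
rewrite (_ : E_ ^~ (stepn N t f) = (fun n => E_ (n + 1)%N f))//.
apply/funext => n.
by rewrite /E_ !per2_frac2//; [rewrite iterD|exact: per2_stepn].
Qed.

(** Write [k = r + n * N] with [r < N]. The [n] whole periods give the decay, since the means
    vanish, and the other [r] steps only average; dividing by [q ^+ N] compensates for those [r]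
    steps. *)
Lemma iter_decay q phi M : 0 < q < 1 ->
  (forall t f D, bmeas f -> per2 f -> oscle D f -> oscle (q * D) (step t f)) ->
  forall pi : R -> probability RR R,
  (forall t, inv_prob N sigma v1 v2 t (pi t)) ->
  (forall s, bmeas (phi s)) -> (forall s, per2 (phi s)) ->
  (forall s, phi (s + 1) = phi s) -> (forall s x, `|phi s x| <= M) ->
  (forall s, Rintegral (pi s) setT (phi s) = 0) ->
  forall k t x, `|iter k I phi t x| <= 2 * M / q ^+ N * q ^+ k.
Proof.
move=> /andP[q0 q1] hq pi hpi bphi pphi tphi phiM phi0 k t x.
pose n := (k %/ N)%N; pose r := (k %% N)%N.
have kE : k = (r + n * N)%N by rewrite addnC -divn_eq.
pose psi := iter n (iter N I) phi.
have psiE s : psi s = iter n (stepn N s) (phi s) by exact: iter_iter_period.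
have bpsi s : bmeas (psi s).
  by rewrite psiE; exact: (markov_iter n (markov_stepn N s)).2.
have M0 : 0 <= M := le_trans (normr_ge0 _) (phiM t x).
have psiM s y : `|psi s y| <= (q ^+ N) ^+ n * (2 * M).
  rewrite psiE -[X in `|X|]subr0 -(phi0 s).
  by apply: period_ergodic => //; apply: oscle_bound.
rewrite {1}kE iterD iterM -/psi iter_one_step//.
apply: le_trans (bexp_norm ((markov_stepn r t).1 x) (bpsi _) (psiM _)) _.
rewrite mulrC -!mulrA !ler_wpM2l// mulrC ler_pdivlMr ?exprn_gt0//.
rewrite -exprM -exprD ler_wiXn2l ?ltW//.
by rewrite {1}kE addnC mulnC leq_add2l ltnW// ltn_mod.
Qed.

End Scheme.

(** * Time slices of the data, and the three claims *)

Lemma smooth2_measurable (R : realType) (v : R -> R -> R) t :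
  smooth2 v -> measurable_fun setT (v t).
Proof.
move=> /(_ 0%N) /= cv; apply: continuous_measurable_fun => y.
have c : (t, z) @[z --> y] --> (t, y) by exact: (cvg_pair (cvg_cst t) cvg_id).
exact: (cvg_comp _ _ c (cv (t, y))).
Qed.

Lemma le_supnorm (R : realType) (phi : stfun R) t x : inB phi ->
  `|phi t x| <= supnorm phi.
Proof.
move=> [_ [[M phiM] _]]; apply: ub_le_sup; last by exists (t, x).
by exists M => _ [p _ <-].
Qed.

Lemma inB_slice (R : realType) (phi : stfun R) : inB phi ->
  [/\ forall s, bmeas (phi s), forall s, per2 (phi s) & forall s, phi (s + 1) =
    phi s].
Proof.
move=> [mphi [[M phiM] pphi]]; split=> s.
- split; last by exists M.
  rewrite (_ : phi s = (fun p : R * (R * R) => phi p.1 p.2) \o pair s)//.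
  by apply: measurableT_comp => //; exact: measurable_pair1.
- by move=> x1 x2; have [_] := pphi s x1 x2.
- by apply/funext => -[x1 x2]; have [] := pphi s x1 x2.
Qed.

Theorem theorem4p2 (R : realType) (sigma : R) (v1 v2 : R -> R -> R) (N : nat)
  (hsigma : 0 < sigma)
  (hv1s : smooth2 v1) (hv2s : smooth2 v2)
  (hv1p : forall t y, v1 (t + 1) y = v1 t y /\ v1 t (y + 1) = v1 t y)
  (hv2p : forall t y, v2 (t + 1) y = v2 t y /\ v2 t (y + 1) = v2 t y)
  (hv1m : forall t, Rintegral lebesgue_measure `[0, 1] (v1 t) = 0)
  (hv2m : forall t, Rintegral lebesgue_measure `[0, 1] (v2 t) = 0)
  (hN : (0 < N)%N) :
  let I := one_step N sigma v1 v2 in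
  (exists pi : R -> probability (R * R)%type R,
      forall tau, inv_prob N sigma v1 v2 tau (pi tau)) /\
  forall pi : R -> probability (R * R)%type R,
    (forall tau, inv_prob N sigma v1 v2 tau (pi tau)) ->
    (* (a) *)
    (exists C rho : R, 0 < C /\ 0 < rho /\
       forall (phi : stfun R) (n : nat), inB phi ->
       forall (tau : R) (x : R * R),
         `| iter n (iter N I) phi tau x
            - Rintegral (pi tau) setT (phi tau) |
         <= C * supnorm phi * expR (- (rho * n%:R)))
    (* (b) *)
    /\ (forall phi : stfun R, inB phi ->
          (forall s, Rintegral (pi s) setT (phi s) = 0) ->
          forall (tau : R) (x : R * R),
            cvgn (series (fun i => iter i.+1 I phi tau x)))
    (* (c) *)
    /\ (forall w : stfun R, inB w ->
          ((forall tau x, iter N I w tau x = w tau x) <->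
           exists c : R -> R, (forall t, c (t + 1) = c t) /\
                              forall tau x, w tau x = c tau)).
Proof.
move=> I.
have mv1 t := smooth2_measurable t hv1s.
have mv2 t := smooth2_measurable t hv2s.
split.
  have /choice[pi hpi] : forall t, exists P, inv_prob N sigma v1 v2 t P by
    exact: invariant_exists.
  by exists pi.
move=> pi hpi.
have [q /andP[q0 q1] hq] := step_contraction hsigma hN mv1 mv2.
have Q0 : 0 < q ^+ N by rewrite exprn_gt0.
have Q1 : q ^+ N < 1 by rewrite exprn_ilt1 -?lt0n// ltW.
have decay phi n t x : inB phi ->
    `|iter n (iter N I) phi t x - Rintegral (pi t) setT (phi t)| <=
    (q ^+ N) ^+ n * (2 * supnorm phi).
  move=> hphi; have [bphi pphi tphi] := inB_slice hphi.
  rewrite iter_iter_period//; apply: period_ergodic => //.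
  by apply: oscle_bound => y; exact: le_supnorm.
split; [|split].
(* A function bounded by [supnorm phi] has oscillation at most [2 * supnorm phi]; the rate is chosen
   so that [expR (- rho) = q ^+ N]. *)
- exists 2, (- ln (q ^+ N)); split => //; split;
    first by rewrite oppr_gt0 ln_lt0// Q0.
  move=> phi n hphi t x; apply: le_trans (decay _ _ _ _ hphi) _.
  by rewrite mulrC mulNr opprK (mulrC (ln _)) expRM_natl lnK.
- move=> phi hphi phi0 t x; have [bphi pphi tphi] := inB_slice hphi.
  (* The series starts with one step of the chain, so its [k]-th term is the iterate of order
     [k.+1]; this is the extra factor [q]. *)
  apply: (@geometric_series_cvg _ _ (2 * supnorm phi / q ^+ N * q) q);
    first by rewrite ltW.
  move=> k; rewrite -mulrA -exprS.
  apply: iter_decay hpi _ _ _ _ _ _ _ _ => //; first by rewrite q0.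
  by move=> s y; exact: le_supnorm.
- move=> w hw; have [bw pw tw] := inB_slice hw; split.
  + move=> wI; exists (fun t => w t (0, 0)); split=> [t|t x];
      first by rewrite tw.
    have wn n : iter n (iter N I) w = w.
      elim: n => // n IH; rewrite iterS IH; apply/funext => s;
        apply/funext => y.
      exact: wI.
    (* As [w] equals all its iterates, the decay estimate bounds the distance from [w t y] to the
       mean of [w t] by a sequence tending to 0; hence [w t] is constant. *)
    suff w_pi y : w t y = Rintegral (pi t) setT (w t) by rewrite !w_pi.
    apply/eqP; rewrite -subr_eq0 -normr_le0.
    have lim0 : (q ^+ N) ^+ n * (2 * supnorm w) @[n --> \oo] --> 0.
      rewrite -[X in _ --> X](mul0r (2 * supnorm w)); apply: cvgMr_tmp.
      by apply: cvg_expr; rewrite ger0_norm// ltW.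
    rewrite -(cvg_lim (@Rhausdorff R) lim0); apply: limr_ge;
      first exact: cvgP lim0.
    by apply: nearW => n; have := decay w n t y hw; rewrite wn.
  + move=> [c [_ wc]] t x; rewrite iter_period//.
    (* Conversely, Markov operators fix constants, and each slice of [w] is one. *)
    have -> : w t = cst (c t) by apply/funext => y; exact: wc.
    exact: (bexp_cst ((markov_stepn sigma N mv1 mv2 N t).1 x) (c t)).
Qed.
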